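(* Let $\Gamma$ be a minimal prime graph. Then every edge of its complement $\overline{\Gamma}$ is contained in a 5-cycle of $\overline{\Gamma}$.
   Context: All graphs are finite and simple; $\overline{\Gamma}$ denotes the complement of the graph $\Gamma$. A minimal prime graph (MPG) is a graph $\Gamma$ with 2 or more vertices such that: (1) $\Gamma$ is connected; (2) $\overline{\Gamma}$ is triangle-free; (3) $\overline{\Gamma}$ is 3-colorable; (4) removing any edge from $\Gamma$ (equivalently, adding that edge to $\overline{\Gamma}$) yields a graph violating (2) or (3). A cycle of length $n$ in a graph is a sequence of distinct vertices $(c_1,\dots,c_n)$ with $(c_i,c_{i+1})$ an edge for $i=1,\dots,n$, where $c_{n+1}=c_1$; it is not required to be induced. *)

(* Defs.v *)
From mathcomp Require Import all_boot.

Set Implicit Arguments.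
Unset Strict Implicit.
Unset Printing Implicit Defensive.

(* A finite simple graph is its adjacency relation [e] on a finite type of
   vertices. *)

Definition simple_graph (T : finType) (e : rel T) : Prop :=
  symmetric e /\ irreflexive e.

Definition compl_graph (T : finType) (e : rel T) : rel T :=
  [rel x y | (x != y) && ~~ e x y].

Definition del_edge (T : finType) (e : rel T) (x y : T) : rel T :=
  [rel u v | e u v && ([set u; v] != [set x; y])].

Definition connected_graph (T : finType) (e : rel T) : Prop :=
  forall x y : T, connect e x y.

(* For irreflexive [e], the three vertices are automatically distinct. *)
Definition triangle_free (T : finType) (e : rel T) : Prop :=
  forall x y z : T, ~ [/\ e x y, e y z & e z x].

Definition colorable (k : nat) (T : finType) (e : rel T) : Prop :=
  exists c : T -> 'I_k, forall x y : T, e x y -> c x != c y.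

Record minimal_prime_graph (T : finType) (e : rel T) : Prop := {
  mpg_simple : simple_graph e;
  mpg_card : 2 <= #|T|;
  mpg_connected : connected_graph e;
  mpg_triangle_free : triangle_free (compl_graph e);
  mpg_colorable : colorable 3 (compl_graph e);
  mpg_minimal : forall x y : T, e x y ->
    ~ triangle_free (compl_graph (del_edge e x y)) \/
    ~ colorable 3 (compl_graph (del_edge e x y))
}.

(* [next] is cyclic, so the last vertex of [c] is followed by the first. *)
Definition edge_in_cycle (T : finType) (e : rel T) (n : nat) (x y : T) : Prop :=
  exists c : n.-tuple T,
    [/\ ucycle e c, x \in c, y \in c & next c x = y \/ next c y = x].

(* Main.v *)
Require Import Defs.
From mathcomp Require Import all_boot.

Set Implicit Arguments.
Unset Strict Implicit.
Unset Printing Implicit Defensive.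

(** Let [G] be the complement of the minimal prime graph. Minimality says that
    [G] is saturated ([mpg_saturated]): two non-adjacent vertices without a
    common neighbour get the same colour in every proper 3-colouring of [G].
    Suppose that the edge [xy] of [G] lies in no pentagon. The key point is that
    the distance from [x], with all distances [>= 3] identified with [0], is
    then a proper 3-colouring of [G] ([dist_color_proper]): saturation applied
    to an arbitrary 3-colouring makes the vertices at distance [>= 3] share the
    colour of [x], and those at distance 2 that are not neighbours of [y] share
    the colour of [y].

    Saturation can now be applied to this explicit colouring, whose colour class
    of [y] is exactly the neighbourhood of [x]. It follows that every vertex is
    adjacent to [x] or [y] ([dominating_edge]), and that every neighbour of [x]
    is adjacent to every neighbour of [y] ([complete_neighbourhoods]). So [G] is
    complete bipartite and its complement is disconnected, a contradiction. *)

Definition proper_coloring (T : finType) (k : nat) (G : rel T)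
    (c : T -> 'I_k) : Prop :=
  forall u v, G u v -> c u != c v.

Definition saturated (T : finType) (k : nat) (G : rel T) : Prop :=
  forall u v, u != v -> ~~ G u v -> (forall w, G u w -> G w v -> False) ->
  forall c : T -> 'I_k, proper_coloring G c -> c u = c v.

(** In a triangle-free graph, [a != y] and [b != x] make all five vertices
    [x a m b y] distinct. *)
Definition pentagon_free_edge (T : finType) (G : rel T) (x y : T) : Prop :=
  forall a m b, G x a -> a != y -> G a m -> G m b -> b != x -> G b y -> False.

Lemma compl_graph_sym (T : finType) (e : rel T) :
  symmetric e -> symmetric (compl_graph e).
Proof. by move=> se u v; rewrite /compl_graph /= eq_sym se. Qed.

Lemma compl_del_edge (T : finType) (e : rel T) (u v a b : T) :
  compl_graph (del_edge e u v) a b ->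
  [\/ compl_graph e a b, a = u /\ b = v | a = v /\ b = u].
Proof.
rewrite /compl_graph /= negb_and negbK => /andP[ab /orP[nab|/eqP abE]].
  by constructor 1; rewrite ab.
have : a \in [set u; v] by rewrite -abE set21.
have : b \in [set u; v] by rewrite -abE set22.
move: ab; rewrite !inE => ab /orP[]/eqP bE /orP[]/eqP aE; subst a b.
- by rewrite eqxx in ab.
- by constructor 3.
- by constructor 2.
- by rewrite eqxx in ab.
Qed.

(** If [u] and [v] had different colours and no common neighbour, the edge [uv]
    of [e] could be deleted: the colouring would stay proper, and a new triangle
    would use [uv] together with a common neighbour. *)
Lemma mpg_saturated (T : finType) (e : rel T) :
  minimal_prime_graph e -> saturated 3 (compl_graph e).
Proof.
case=> -[se _] _ _ tf _ min u v uv nGuv nouv c pc; apply/eqP.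
have Gs := compl_graph_sym se.
set G := compl_graph e in nGuv nouv pc Gs tf *.
set G' := compl_graph (del_edge e u v).
have euv : e u v by move: nGuv; rewrite /G /compl_graph /= uv negbK.
apply: contraT => cuv; case: (min u v euv) => [] bad; case: bad.
- have Girr w : G' w w = false by rewrite /G' /compl_graph /= eqxx.
  (* Two edges of a triangle cannot both join [u] to [v]. *)
  have old p q r : G' p q -> G' q r -> G' r p -> G p q.
    move=> /compl_del_edge[//|[-> ->]|[-> ->]] vr ru; exfalso.
    + case: (nouv r).
      * case: (compl_del_edge ru) => [|[_ uE]|[rE _]]; first by rewrite Gs.
        - by rewrite uE eqxx in uv.
        - by rewrite rE Girr in vr.
      * case: (compl_del_edge vr) => [|[vE _]|[_ rE]]; first by rewrite Gs.
        - by rewrite vE eqxx in uv.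
        - by rewrite rE Girr in ru.
    + case: (nouv r).
      * case: (compl_del_edge vr) => [//|[_ rE]|[uE _]].
        - by rewrite rE Girr in ru.
        - by rewrite uE eqxx in uv.
      * case: (compl_del_edge ru) => [//|[rE _]|[_ vE]].
        - by rewrite rE Girr in vr.
        - by rewrite vE eqxx in uv.
  move=> p q r [pq qr rp]; apply: (tf p q r); split.
  + exact: old pq qr rp.
  + exact: old qr rp pq.
  + exact: old rp pq qr.
- exists c => a b /compl_del_edge[/pc //|[-> ->] //|[-> ->]].
  by rewrite eq_sym.
Qed.

Section PentagonFreeEdge.

Variables (T : finType) (G : rel T).
Hypotheses (Gsym : symmetric G) (Girr : irreflexive G).
Hypotheses (Gtf : triangle_free G) (Gsat : saturated 3 G).

Lemma pentagon_free_edgeC x y :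
  pentagon_free_edge G x y -> pentagon_free_edge G y x.
Proof.
move=> nop a m b ya ax am mb byy bx.
by apply: (nop b m a) => //; rewrite Gsym.
Qed.

(** This is the distance from [x], with [0] standing also for all distances
    [>= 3]; merging them is what keeps the number of colours down to three. *)
Definition dist_color (x v : T) : 'I_3 :=
  if G x v then inord 1
  else if (v != x) && [exists a, G x a && G a v] then inord 2
  else inord 0.

Lemma eq_dist_color_nbr x y v :
  G x y -> dist_color x v = dist_color x y -> G x v.
Proof.
move=> xy; rewrite /dist_color xy; case: ifP => // _.
by case: ifP => _ /(congr1 val); rewrite /= !inordK.
Qed.

Variables (c : T -> 'I_3) (c_proper : proper_coloring G c).

Lemma far_vertex_color x v :
  ~~ G x v -> ~~ ((v != x) && [exists a, G x a && G a v]) -> c v = c x.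
Proof.
move=> nxv; have [-> //|vx /= far] := eqVneq v x.
apply/esym/Gsat => // [|w xw wv]; first by rewrite eq_sym.
by case/existsP: far; exists w; rewrite xw.
Qed.

(** A common neighbour of [u] and [y] would close a pentagon through [xy]. *)
Lemma second_nbr_color x y a u :
    G x y -> pentagon_free_edge G x y -> ~~ G x u -> ~~ G y u ->
  G x a -> G a u -> c u = c y.
Proof.
move=> xy nop nxu nyu xa au.
have ay : a != y by apply: contraNneq nyu => <-.
apply: Gsat => // [||w uw wy].
- by apply: contraNneq nxu => ->.
- by rewrite Gsym.
- apply: (nop a u w) => //.
  by apply: contraNneq nxu => <-; rewrite Gsym.
Qed.

(** Two adjacent vertices at distance 1 would form a triangle with [x]. At
    distance 2, if one of them is adjacent to [y], the edge between them closes
    a triangle or a pentagon through [xy]; otherwise both have the colour of [y]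
    under [c]. At distance [>= 3] both have the colour of [x] under [c]. *)
Lemma dist_color_proper x y :
  G x y -> pentagon_free_edge G x y -> proper_coloring G (dist_color x).
Proof.
move=> xy nop u v uv; apply/eqP => duv.
have cuv := c_proper uv.
have same_class b1 b2 b1' b2' :
    (if b1 then inord 1 else if b2 then inord 2 else inord 0) =
    (if b1' then inord 1 else if b2' then inord 2 else inord 0) :> 'I_3 ->
  (b1, ~~ b1 && b2) = (b1', ~~ b1' && b2').
  by move: b1 b2 b1' b2' => [] [] [] [] /(congr1 val); rewrite /= !inordK.
move/same_class: duv => [].
case xu: (G x u) => [|] xv; move/esym: xv => xv.
  by move=> _; apply: (@Gtf x u v); rewrite xu uv Gsym xv.
rewrite xv /=.
case du: (_ && _) => [|] dv; move/esym: dv => dv; last first.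
  have cu : c u = c x by apply: far_vertex_color; rewrite ?xu ?du.
  have cv : c v = c x by apply: far_vertex_color; rewrite ?xv ?dv.
  by rewrite cu cv eqxx in cuv.
case/andP: du => ux /existsP[a /andP[xa au]].
case/andP: dv => vx /existsP[b /andP[xb bv]].
have far_from_y p q r : G x q -> G q r -> G r p -> p != x -> ~~ G y p.
  move=> xq qr rp px; apply/negP => yp.
  have [qy|qy] := eqVneq q y.
    by apply: (@Gtf y r p); rewrite -{1}qy qr rp Gsym yp.
  by apply: (nop q r p) => //; rewrite Gsym.
have cu : c u = c y.
  apply: (@second_nbr_color x y a) => //; first by rewrite xu.
  by apply: (far_from_y u b v) => //; rewrite Gsym.
have cv : c v = c y.
  apply: (@second_nbr_color x y b) => //; first by rewrite xv.
  by apply: (far_from_y v a u).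
by rewrite cu cv eqxx in cuv.
Qed.

(** A vertex [v] off both neighbourhoods has a different colour from [y] in
    [dist_color x] and from [x] in [dist_color y], so it has a common neighbour
    with each of them, which closes a pentagon. *)
Lemma dominating_edge x y v :
  G x y -> pentagon_free_edge G x y -> G x v || G y v.
Proof.
move=> xy nop; apply: contraT; rewrite negb_or => /andP[nxv nyv].
have common x' y' : G x' y' -> pentagon_free_edge G x' y' -> ~~ G x' v ->
    ~~ G y' v -> exists2 w, G v w & G w y'.
  move=> xy' nop' nxv' nyv'.
  have [/existsP[w /andP[vw wy]]|/existsPn none] :=
    boolP [exists w, G v w && G w y']; first by exists w.
  case/negP: (nxv'); apply: (eq_dist_color_nbr xy').
  apply: Gsat (dist_color_proper xy' nop') => [||w vw wy].
  - by apply: contraNneq nxv' => ->.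
  - by rewrite Gsym.
  - by move: (none w); rewrite vw wy.
have [b vb byy] := common x y xy nop nxv nyv.
have yx : G y x by rewrite Gsym.
have [a va ax] := common y x yx (pentagon_free_edgeC nop) nyv nxv.
case: (nop a v b) => //; try by rewrite Gsym.
- by apply: contraNneq nyv => <-; rewrite Gsym.
- by apply: contraNneq nxv => <-; rewrite Gsym.
Qed.

(** Non-adjacent [u] and [v] could not have a common neighbour, as it would close
    a pentagon, yet [dist_color x] separates them: [u] is at distance 1 from [x]
    and [v] is not. *)
Lemma complete_neighbourhoods x y u v :
  G x y -> pentagon_free_edge G x y -> G x u -> G y v -> G u v.
Proof.
move=> xy nop xu yv.
have [-> //|uy] := eqVneq u y.
have [->|vx] := eqVneq v x; first by rewrite Gsym.
have nxv : ~~ G x v.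
  by apply/negP => xv; apply: (@Gtf x y v); rewrite xy yv Gsym xv.
apply: contraT => nuv; case/negP: (nxv); apply: (eq_dist_color_nbr xu).
symmetry; apply: Gsat (dist_color_proper xy nop) => // [|w uw wv].
- apply: contraTneq xu => ->; apply/negP => xv.
  by apply: (@Gtf x y v); rewrite xy yv Gsym xv.
- by apply: (nop u w v) => //; rewrite Gsym.
Qed.

Lemma pentagon_of_path x y a m b :
    G x y -> G x a -> a != y -> G a m -> G m b -> b != x -> G b y ->
  edge_in_cycle G 5 x y.
Proof.
move=> xy xa ay am mb bx byy.
have neq u v : G u v -> u != v.
  by apply: contraTneq => ->; rewrite Girr.
have yx : G y x by rewrite Gsym.
have xm : x != m.
  by apply/eqP => xm; subst m; apply: (@Gtf x b y).
have ym : m != y.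
  by apply/eqP => my; subst m; apply: (@Gtf x a y).
have ab : a != b.
  by apply/eqP => ab; subst b; apply: (@Gtf x a y).
exists [tuple x; a; m; b; y]; split.
- rewrite /ucycle /= xa am mb byy yx /= !inE !negb_or.
  by rewrite (neq x a) // xm (eq_sym x b) bx (neq x y) // (neq a m) // ab ay
    (neq m b) // ym (neq b y).
- by rewrite !inE eqxx.
- by rewrite !inE eqxx !orbT.
- right; rewrite /= (negbTE (neq y x yx)) !(eq_sym y) (negbTE ay) (negbTE ym).
  by rewrite (negbTE (neq b y byy)) eqxx.
Qed.

End PentagonFreeEdge.

Theorem theorem4p14 (T : finType) (e : rel T) (mpg_e : minimal_prime_graph e)
    (x y : T) (exy : compl_graph e x y) :
  edge_in_cycle (compl_graph e) 5 x y.
Proof.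
have Gsat := mpg_saturated mpg_e.
case: mpg_e => -[se _] _ conn Gtf [c c_proper] _.
set G := compl_graph e in exy Gtf c_proper Gsat *.
have Gsym : symmetric G by apply: compl_graph_sym.
have Girr : irreflexive G by move=> v; rewrite /G /compl_graph /= eqxx.
pose path a m b := [&& G x a, a != y, G a m, G m b, b != x & G b y].
have [/existsP[a /existsP[m /existsP[b]]]|nopath] :=
  boolP [exists a, exists m, exists b, path a m b].
  by case/and5P=> xa ay am mb /andP[bx byy];
    exact: (pentagon_of_path Gsym Girr Gtf exy xa ay am mb bx byy).
have nop : pentagon_free_edge G x y.
  move=> a m b xa ay am mb bx byy; case/existsP: nopath; exists a.
  apply/existsP; exists m; apply/existsP; exists b.
  by rewrite /path xa ay am mb bx.
(* An [e]-edge leaving the [G]-neighbourhood of [x] would end in that of [y]. *)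
have stable u v : e u v -> G x u -> G x v.
  move=> euv xu; apply: contraTT euv => nxv.
  have := dominating_edge Gsym Gtf Gsat c_proper v exy nop.
  rewrite (negbTE nxv) /= => yv.
  have : G u v by apply: (complete_neighbourhoods Gsym Gtf Gsat c_proper exy nop).
  by case/andP.
have Gclosed : closed e (G x).
  by apply: (intro_closed (sym_connect_sym se)) => u v euv; apply: stable.
have : G x x = G x y := closed_connect Gclosed (conn x y).
by rewrite Girr exy.
Qed.
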